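(* (i) Let $A=\mathbf N=\{1,2,\dots\}$ and let $\mathcal F_k=\sigma\{X_j,\ j\le k\}$. For every $F\in\mathbf D$, $$F=\mathbf E[F]+\sum_{k=1}^{\infty}D_k\,\mathbf E[F\,|\,\mathcal F_k],$$ the series converging in $L^2(E_A)$. (ii) Let $A$ be finite (with no privileged order). For every $F\in\mathbf D$, $$F=\mathbf E[F]+\sum_{\emptyset\neq B\subset A}\binom{|A|}{|B|}^{-1}\frac1{|B|}\sum_{b\in B}D_b\,\mathbf E[F\,|\,X_B].$$
   Context: $A$ is an at most countable set, $(E_a,\mathcal E_a,\mathbf P_a)_{a\in A}$ are Polish spaces with probability measures, $E_A=\prod_{a\in A}E_a$ carries the product $\sigma$-field and the product measure $\mathbf P=\otimes_{a\in A}\mathbf P_a$, with expectation $\mathbf E$. $X_a$ ($a\in A$) are the coordinate random variables (hence independent) and $X_B=(X_a,a\in B)$ for $B\subset A$. $L^2(E_A)=L^2(E_A,\mathbf P)$, and $L^2(A\times E_A)$ is the space of families $U=(U_a)_{a\in A}$ of random variables with $\|U\|^2=\sum_{a\in A}\mathbf E[U_a^2]<\infty$. A random variable is cylindrical if it belongs to $L^2(E_A)$ and depends only on $X_B$ for some finite $B\subset A$. The gradient $DF=(D_aF)_{a\in A}$ is defined by $$D_aF(X_A)=F(X_A)-\int_{E_a}F(X_{A\setminus\{a\}},x_a)\,d\mathbf P_a(x_a)=F-\mathbf E[F\,|\,\mathcal G_a],\qquad \mathcal G_a=\sigma\{X_b,\ b\ne a\}.$$ $\mathbf D$ is the closure of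 the cylindrical random variables for the norm $\|F\|_{1,2}=(\|F\|^2_{L^2(E_A)}+\|DF\|^2_{L^2(A\times E_A)})^{1/2}$; the formula for $D_aF$ remains valid on $\mathbf D$. *)

(* Defs.v *)
From HB Require Import structures.
From mathcomp Require Import all_boot all_order all_algebra finmap.
From mathcomp Require Import all_classical all_reals all_analysis.

Set Implicit Arguments.
Unset Strict Implicit.
Unset Printing Implicit Defensive.
Import Order.TTheory GRing.Theory Num.Theory.
Import numFieldNormedType.Exports.

Local Open Scope classical_set_scope.
Local Open Scope ring_scope.

Section polish.
Context (R : realType) (T : topologicalType).

Definition is_metric (d : T -> T -> R) :=
  [/\ forall x y, d x y = 0 <-> x = y,
      forall x y, d x y = d y x
    & forall x y z, d x z <= d x y + d y z].

Definition metrizes (d : T -> T -> R) :=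
  forall x (U : set T),
    nbhs x U <-> exists2 e : R, 0 < e & [set y | d x y < e] `<=` U.

Definition complete_metric (d : T -> T -> R) :=
  forall u : nat -> T,
    (forall e : R, 0 < e ->
       exists N, forall m n, (N <= m)%N -> (N <= n)%N -> d (u m) (u n) < e) ->
    exists l : T, u @ \oo --> l.

Definition polish :=
  (exists2 S : set T, countable S & dense S) /\
  (exists d : T -> T -> R, [/\ is_metric d, metrizes d & complete_metric d]).

End polish.

Definition borel (T : ptopologicalType) := g_sigma_algebraType (@open T).

Section product_space.
Context (A : countType) (E : A -> ptopologicalType).

(* Events X_a \in M with a \in B and M Borel; they generate sigma(X_B). *)
Definition coord_events (B : set A) : set_system (forall a, E a) :=
  \bigcup_(a in B)
    preimage_set_system setT (fun x => x a) (@measurable _ (borel (E a))).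

Definition prod_space := g_sigma_algebraType (coord_events setT).

Context (R : realType).

(* Characterizes P uniquely (pi-lambda theorem), for A finite or countable. *)
Definition is_product_measure (Pa : forall a, probability (borel (E a)) R)
    (P : probability prod_space R) :=
  forall (J : {fset A}) (M : forall a, set (borel (E a))),
    (forall a, measurable (M a)) ->
    (P [set x : prod_space | forall a, a \in J -> M a (x a)] =
      \prod_(a <- J) Pa a (M a))%E.

(* G is a generating family: Y is a version of E[F | sigma(G)], with
   sigma(G) = <<s G >>. *)
Definition is_condexp (P : probability prod_space R)
    (G : set_system prod_space) (F Y : prod_space -> R) :=
  [/\ measurable_fun [set: g_sigma_algebraType G]
        (Y : g_sigma_algebraType G -> R),
      P.-integrable setT (EFin \o Y)
    & forall S, <<s G >> S ->
        (\int[P]_(x in S) (Y x)%:E = \int[P]_(x in S) (F x)%:E)%E].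

Definition condexp (P : probability prod_space R)
    (G : set_system prod_space) (F : prod_space -> R) : prod_space -> R :=
  xget (cst 0) [set Y | is_condexp P G F Y].

(* The section integral uses the value 0 where F is not integrable along
   coordinate a, a P-null set of x for F in L^2. *)
Definition grad (Pa : forall a, probability (borel (E a)) R)
    (a : A) (F : prod_space -> R) : prod_space -> R :=
  fun x => F x - \int[Pa a]_y F (dfwith x a y).

Definition cylindrical (P : probability prod_space R) (F : prod_space -> R) :=
  F \in Lfun P 2%:E /\
  exists2 B : set A, finite_set B &
    forall x y : prod_space, (forall a, B a -> x a = y a) -> F x = F y.

Definition norm12 (Pa : forall a, probability (borel (E a)) R)
    (P : probability prod_space R) (F : prod_space -> R) : \bar R :=
  (((\int[P]_x (F x ^+ 2)%:E) +
    \esum_(a in [set: A]) \int[P]_x (grad Pa a F x ^+ 2)%:E) `^ 2^-1)%E.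

(* The space D: the closure, inside L^2, of the cylindrical variables for
   norm12, with grad given by its defining formula on all of L^2. *)
Definition sobolev (Pa : forall a, probability (borel (E a)) R)
    (P : probability prod_space R) (F : prod_space -> R) :=
  F \in Lfun P 2%:E /\
  forall e : R, 0 < e ->
    exists2 G, cylindrical P G & (norm12 Pa P (F \- G)%R < e%:E)%E.

Definition L2_series (P : probability prod_space R)
    (u : nat -> prod_space -> R) (S : prod_space -> R) :=
  [/\ forall k, u k \in Lfun P 2%:E,
      S \in Lfun P 2%:E
    & (fun n => 'N[P]_2%:E[EFin \o (fun x => \sum_(k < n) u k x - S x)%R])%E
        @ \oo --> 0%E].

End product_space.

Arguments coord_events {A} E B.

(* Main.v *)
Require Import Defs.
From HB Require Import structures.
From mathcomp Require Import all_boot all_order all_algebra finmap.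
From mathcomp Require Import all_classical all_reals all_analysis.
From mathcomp Require Import measurable_realfun.

Set Implicit Arguments.
Unset Strict Implicit.
Unset Printing Implicit Defensive.
Import Order.TTheory GRing.Theory Num.Theory.
Import numFieldNormedType.Exports.

Local Open Scope classical_set_scope.
Local Open Scope ring_scope.

(* Under the product measure, E[Y | X_B] has the explicit version
   [partial_mean B Y], which integrates out the coordinates outside B.
   Averaging over coordinate a is the case where B is the complement of {a};
   composing it with E[. | X_B] gives E[. | X_(B \ {a})], so almost surely
     D_a E[F | X_B] = E[F | X_B] - E[F | X_(B \ {a})].
   The sum in (i) then telescopes to E[F | X_1, ..., X_n] - E[F], which converges
   in L^2 because partial means are L^2-contractions that fix a cylindrical
   variable once n is large enough. In (ii) the term E[F | X_B] is collected
   with weight 1 / C(n,|B|) from D_b E[F | X_B] with b in B, and with weight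
   -(n - |B|) / (C(n,|B|+1) (|B|+1)) = - 1 / C(n,|B|) from the subsets
   having one more element, so that only B = A and B = {} survive. *)

(** * Preliminaries on integrals, limits and square integrability *)

(** The positive and negative parts are transported separately, so the two integrals agree even when
    [f] is not integrable. Later identities can thus hold at every point, default values
    included. *)
Lemma integral_pushforwardT d d' (T : measurableType d) (T' : measurableType d')
    (R : realType) (mu : {measure set T -> \bar R}) (phi : T -> T')
    (f : T' -> \bar R) :
  measurable_fun setT phi -> measurable_fun setT f ->
  (\int[pushforward mu phi]_y f y = \int[mu]_x f (phi x))%E.
Proof.
move=> mphi mf; rewrite [LHS]integralE [RHS]integralE; congr (_ - _)%E.
  rewrite ge0_integral_pushforward //; last exact: measurable_funepos.
  by apply: eq_integral => x _ /=; rewrite !funeposE.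
rewrite ge0_integral_pushforward //; last exact: measurable_funeneg.
by apply: eq_integral => x _ /=; rewrite !funenegE.
Qed.

Lemma cvge0_lt (R : realType) (f : nat -> \bar R) :
  (forall n, 0 <= f n)%E ->
  (forall e : R, 0 < e -> exists n0, forall n, (n0 <= n)%N -> (f n < e%:E)%E) ->
  f @ \oo --> 0%E.
Proof.
move=> f0 fe; apply/fine_cvgP; split.
  have [n0 fn0] := fe 1 ltr01; exists n0 => // n /= /fn0 fn.
  by rewrite ge0_fin_numE // (lt_trans fn) ?ltry.
apply/cvgr0Pnorm_lt => e e0; have [n0 fn0] := fe e e0; exists n0 => // n /= /fn0 fn.
rewrite /= ger0_norm ?fine_ge0 //.
by rewrite -lte_fin fineK // ge0_fin_numE // (lt_trans fn) ?ltry.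
Qed.

Lemma Lfun2_integrable d (T : measurableType d) (R : realType)
    (P : probability T R) (f : T -> R) :
  f \in Lfun P 2%:E -> P.-integrable setT (EFin \o f).
Proof.
by move=> f2; apply/Lfun1_integrable; rewrite (Lfun_subset12 _ f2) ?fin_num_measure.
Qed.

Section square_integrable.
Context d (T : measurableType d) (R : realType).
Local Open Scope ereal_scope.

Lemma Lnorm2E (mu : {measure set T -> \bar R}) (f : T -> R) :
  'N[mu]_2%:E[EFin \o f] = (\int[mu]_x (f x ^+ 2)%:E) `^ 2^-1.
Proof.
rewrite unlock; congr (_ `^ _); apply: eq_integral => x _ /=.
by rewrite powR_mulrn // real_normK // num_real.
Qed.

Lemma Lfun2P (mu : {measure set T -> \bar R}) (f : T -> R) :
  (f \in Lfun mu 2%:E) <->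
  measurable_fun setT f /\ \int[mu]_x (f x ^+ 2)%:E < +oo.
Proof.
rewrite inE; split.
  move=> /andP[]; rewrite !inE /= /finite_norm Lnorm2E => mf fy; split => //.
  by apply: lty_poweRy fy; rewrite invr_eq0 pnatr_eq0.
move=> [mf fy]; apply/andP; split; rewrite inE /= ?/finite_norm ?Lnorm2E //.
exact: poweR_lty.
Qed.

(** This is nonnegativity of the variance when [f] is square integrable; otherwise the right side is
    [+oo]. It therefore applies to every section of a measurable function. *)
Lemma sqr_Rintegral_le (P : probability T R) (f : T -> R) :
  measurable_fun setT f ->
  ((\int[P]_x f x) ^+ 2)%R%:E <= \int[P]_x (f x ^+ 2)%:E.
Proof.
move=> mf; have [fy|] := ltP (\int[P]_x (f x ^+ 2)%:E) +oo; last first.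
  by rewrite leye_eq => /eqP ->; rewrite leey.
have f2 : f \in Lfun P 2%:E by apply/Lfun2P.
have f1 := Lfun2_integrable f2.
have := variance_ge0 P f; rewrite varianceE // unlock sube_ge0; last first.
  by rewrite fin_numX // integrable_fin_num.
by rewrite -(@fineK _ (\int[P]_x (f x)%:E)) ?integrable_fin_num //.
Qed.

End square_integrable.

(** * Weighted sums of increments over the subsets of a finite set *)

Section increments.
Local Open Scope set_scope.

(** Inverse form of $(k+1)\binom{n}{k+1} = (n-k)\binom{n}{k}$, where $n-k$ is nonzero. *)
Lemma inv_bin_succ (K : numFieldType) (n k : nat) : (k < n)%N ->
  ('C(n, k.+1)%:R)^-1 * (k.+1%:R)^-1 * (n - k)%:R = ('C(n, k)%:R)^-1 :> K.
Proof.
move=> kn; rewrite -invfM -natrM mulnC mul_bin_left natrM invfM mulrC mulrA.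
by rewrite mulfV ?mul1r // pnatr_eq0 -lt0n subn_gt0.
Qed.

(** The algebra behind (ii): at a fixed sample point, [g B] will be the value of the partial mean
    over [B]. *)
Lemma sum_subset_increments (K : numFieldType) (A : finType) (g : {set A} -> K) :
  \sum_(B : {set A} | B != finset.set0)
    ('C(#|A|, #|B|)%:R)^-1 * (#|B|%:R)^-1 * \sum_(b in B) (g B - g (B :\ b)) =
  g finset.setT - g finset.set0.
Proof.
pose c (B : {set A}) : K := ('C(#|A|, #|B|)%:R)^-1.
pose w (B : {set A}) : K := c B * (#|B|%:R)^-1.
have c0 : c finset.set0 = 1 by rewrite /c cards0 bin0 invr1.
have cT : c finset.setT = 1 by rewrite /c cardsT binn invr1.
have sum_removed : \sum_(B : {set A}) \sum_(b in B) w B * g (B :\ b) =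
    \sum_(C | C != finset.setT) c C * g C.
  transitivity (\sum_(C : {set A}) \sum_(b | b \notin C) w (b |: C) * g C).
    rewrite (exchange_big_dep xpredT) //= [RHS](exchange_big_dep xpredT) //=.
    apply: eq_bigr => b _.
    (* For fixed [b], adding and removing [b] are inverse bijections between the sets [C] without
       [b] and the sets [B] with [b]. *)
    rewrite (reindex_onto (fun C => b |: C) (fun B => B :\ b)) /=; last first.
      by move=> B bB; rewrite finset.setD1K.
    apply: eq_big => [C|C /andP[_ /eqP ->] //].
    rewrite finset.setU11 /=; apply/eqP/idP => [<-|/finset.setU1K //].
    by rewrite finset.setD11.
  rewrite [RHS]big_mkcond; apply: eq_bigr => C _.
  case: ifPn => [CT|/negPn/eqP ->]; last by rewrite big1 // => b; rewrite inE.
  (* Every [b] outside [C] contributes the same weight, that of cardinal [#|C|.+1], and there are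
     [#|A| - #|C|] of them. *)
  rewrite (eq_bigr (fun=> ('C(#|A|, #|C|.+1)%:R)^-1 * (#|C|.+1%:R)^-1 * g C)).
    have CA : (#|C| < #|A|)%N by rewrite -cardsT proper_card // finset.properT.
    rewrite sumr_const -[LHS]mulr_natr mulrAC; congr (_ * _).
    rewrite /c -(inv_bin_succ _ CA); congr (_ * _%:R).
    by rewrite -(cardC (mem C)) addKn.
  by move=> b bC; rewrite /w /c cardsU1 bC.
transitivity (\sum_(B | B != finset.set0) c B * g B -
    \sum_(C | C != finset.setT) c C * g C); last first.
  (* Both sides are the sum of [c B * g B] over all [B], with one end split off; [c] is 1 at both
     ends. *)
  have gT0 : g finset.setT + \sum_(C | C != finset.setT) c C * g C =
      g finset.set0 + \sum_(B | B != finset.set0) c B * g B.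
    transitivity (\sum_B c B * g B).
      by rewrite [RHS](bigD1 finset.setT) //= cT mul1r.
    by rewrite [LHS](bigD1 finset.set0) //= c0 mul1r.
  by apply/eqP; rewrite subr_eq addrAC eq_sym subr_eq gT0 addrC.
(* [sum_removed] ranges over all [B], but its empty set term is an empty sum. *)
rewrite -sum_removed [X in _ - X](bigD1 finset.set0) //=.
rewrite [X in _ - (X + _)]big1 ?add0r; last by move=> b; rewrite inE.
rewrite -sumrB; apply: eq_bigr => B B0; rewrite sumrB mulrBr.
congr (_ - _); last exact: mulr_sumr.
rewrite sumr_const -[g B *+ _]mulr_natl mulrA; congr (_ * _).
by rewrite divfK // pnatr_eq0 cards_eq0.
Qed.
End increments.

(** * Independent coordinates *)

Section coordinates.
Context (A : countType) (E : A -> ptopologicalType).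
Implicit Types (B C : set A) (a : A).

(** Points keep all their coordinates; only the sigma-field shrinks, to $\sigma(X_B)$. The same
    function can thus be measurable for several [B] without restriction maps. *)
Definition coord_space B := g_sigma_algebraType (coord_events E B).

Lemma measurable_coord B a : B a ->
  measurable_fun [set: coord_space B] (fun x => x a : borel (E a)).
Proof.
move=> Ba _ M mM; rewrite setTI; apply: sub_sigma_algebra.
by exists a => //; exists M => //; rewrite setTI.
Qed.

Lemma measurable_fun_coord_space d (T : measurableType d) B
    (f : T -> coord_space B) :
  (forall a, B a -> measurable_fun [set: T] (fun t => f t a : borel (E a))) ->
  measurable_fun [set: T] f.
Proof.
move=> mf.
apply: (@measurability _ _ _ (coord_space B) setT f (coord_events E B)) => //.
move=> _ [_ [a Ba [M mM <-]] <-].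
by rewrite !setTI; have := mf a Ba measurableT M mM; rewrite setTI.
Qed.

(** The sets with this invariance form a sigma-algebra containing the generators. *)
Lemma coord_event_invariant B (S : set (coord_space B)) (x y : coord_space B) :
  measurable S -> (forall a, B a -> x a = y a) -> S x -> S y.
Proof.
pose inv S := forall x y : coord_space B, (forall a, B a -> x a = y a) ->
  S x -> S y.
move=> mS; move: x y; apply: (smallest_sub _ _ mS : inv S).
  split => //.
  (* For complements, the invariance of [X] is used with [x] and [y] exchanged. *)
  - by move=> X IX x y xy [_ nX]; split => // Xy; apply: nX; apply: IX Xy => a /xy.
  - by move=> F IF x y xy [i _ Fi]; exists i => //; exact: IF Fi.
by move=> _ [a Ba [M mM <-]] x y xy; rewrite !setTI /= xy.
Qed.

Lemma coord_space_measurable_sub B C (S : set (forall a, E a)) :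
  B `<=` C -> @measurable _ (coord_space B) S -> @measurable _ (coord_space C) S.
Proof.
move=> BC; apply: smallest_sub; first exact: sigma_algebra_measurable.
by move=> M [a Ba ?]; apply: sub_sigma_algebra; exists a => //; exact: BC.
Qed.

Lemma coord_space_measurable_fun_sub B C d (T : measurableType d)
    (f : (forall a, E a) -> T) :
  B `<=` C -> measurable_fun [set: coord_space B] f ->
  measurable_fun [set: coord_space C] f.
Proof.
by move=> BC mf _ M mM; apply: (coord_space_measurable_sub BC); exact: mf.
Qed.

Definition mix B (x y : prod_space E) : prod_space E :=
  fun a => if `[< B a >] then x a else y a.

(** Reading the coordinates in [C] of the glued point involves [x] only through [B] and [C]
    together. This precision later yields measurability of partial means for the intersection. *)
Lemma measurable_mix B C D : B `&` C `<=` D -> measurable_fun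
  [set: coord_space D * prod_space E] (fun z => mix B z.1 z.2 : coord_space C).
Proof.
move=> BCD; apply: measurable_fun_coord_space => a Ca; rewrite /mix.
case: asboolP => Ba.
  by apply: (measurableT_comp (measurable_coord _)) => //; exact: BCD.
exact: (measurableT_comp (@measurable_coord setT a I) measurable_snd).
Qed.

Lemma mixT x y : mix setT x y = x.
Proof. by apply: functional_extensionality_dep => a; rewrite /mix asboolT. Qed.

Lemma mix0 x y : mix set0 x y = y.
Proof. by apply: functional_extensionality_dep => a; rewrite /mix asboolF. Qed.

Lemma mix_dfwith a x y : mix (~` [set a]) x y = dfwith x a (y a).
Proof.
apply: functional_extensionality_dep => b; rewrite /mix.
have [->|ba] := eqVneq b a; first by rewrite dfwithin asboolF //; apply.
rewrite dfwithout 1?eq_sym // asboolT //; exact/eqP.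
Qed.

End coordinates.

(** * Invariance of the product measure under gluing two independent copies *)

Section product_measure.
Context (A : countType) (E : A -> ptopologicalType) (R : realType).
Context (Pa : forall a, probability (borel (E a)) R)
  (P : probability (prod_space E) R).
Hypothesis PaP : is_product_measure Pa P.
Implicit Types (B C : set A) (a : A).
Local Notation coord_space B := (coord_space E B).

Definition cylinder (J : {fset A}) (M : forall a, set (borel (E a))) :
  set (prod_space E) := [set x | forall a, a \in J -> M a (x a)].

Definition cylinders : set_system (prod_space E) :=
  [set S | exists J M, (forall a, measurable (M a)) /\ S = cylinder J M].

Lemma cylinder1 a (N : set (borel (E a))) :
  cylinder [fset a]%fset (dfwith (fun=> setT) a N) = [set x | N (x a)].
Proof.
apply/seteqP; split => x /=; first by move/(_ a (fset11 a)); rewrite dfwithin.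
by move=> Nx b; rewrite in_fset1 => /eqP ->; rewrite dfwithin.
Qed.

Lemma measurable_dfwith_setT a (N : set (borel (E a))) : measurable N ->
  forall b, measurable (dfwith (fun b => [set: borel (E b)]) a N b).
Proof.
by move=> mN b; case: dfwithP.
Qed.

Lemma measurable_cylinder J (M : forall a, set (borel (E a))) :
  (forall a, measurable (M a)) -> measurable (cylinder J M).
Proof.
move=> mM.
rewrite (_ : cylinder J M =
  \bigcap_(a in [set` J]) [set x : prod_space E | M a (x a)]) //.
apply: fin_bigcap_measurable => [|a _]; first exact: finite_fset.
by rewrite -[X in measurable X]setTI; exact: (@measurable_coord A E setT a I).
Qed.

Lemma cylindersI : setI_closed cylinders.
Proof.
move=> _ _ [J [M [mM ->]]] [J' [M' [mM' ->]]].
(* A side indexed by only one of [J] and [J'] is padded with the whole space. *)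
exists (J `|` J')%fset, (fun a => (if a \in J then M a else setT) `&`
  (if a \in J' then M' a else setT)); split.
  by move=> a; apply: measurableI; case: ifP.
apply/seteqP; split => [x [Mx Mx'] a _ /=|x Mx].
  by split; case: ifP => //; [exact: Mx|exact: Mx'].
split=> a aJ; have /= := Mx a; rewrite in_fsetU aJ ?orbT => /(_ isT)[] //.
Qed.

Lemma measurable_cylinders : @measurable _ (prod_space E) = <<s cylinders >>.
Proof.
apply/seteqP; split; apply: smallest_sub; [exact: smallest_sigma_algebra|
  |exact: smallest_sigma_algebra|].
  move=> _ [a _ [N mN <-]]; apply: sub_sigma_algebra; rewrite setTI.
  exists [fset a]%fset, (dfwith (fun=> setT) a N); split.
    exact: measurable_dfwith_setT.
  by rewrite cylinder1.
by move=> _ [J [M [mM ->]]]; exact: measurable_cylinder.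
Qed.

Lemma measure_cylinder J (M : forall a, set (borel (E a))) :
  (forall a, measurable (M a)) -> P (cylinder J M) = (\prod_(a <- J) Pa a (M a))%E.
Proof. exact: PaP. Qed.

Lemma measure_coord a (N : set (borel (E a))) : measurable N ->
  P [set x | N (x a)] = Pa a N.
Proof.
move=> mN; rewrite -cylinder1 measure_cylinder; last exact: measurable_dfwith_setT.
by rewrite big_seq_fset1 dfwithin.
Qed.

Lemma measurable_mixT B : measurable_fun
  [set: prod_space E * prod_space E] (fun z => mix B z.1 z.2 : prod_space E).
Proof. exact: (@measurable_mix A E B setT setT). Qed.

(** If $x$ and $y$ are independent of law [P], the point with coordinates of $x$ on [B] and of $y$
    elsewhere again has law [P]. Both laws agree on cylinders, a generating family closed under
    intersection. *)
Lemma measure_mix B (S : set (prod_space E)) : measurable S ->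
  (P \x P)%E ((fun z => mix B z.1 z.2) @^-1` S) = P S.
Proof.
move=> mS.
pose mixB (z : prod_space E * prod_space E) : prod_space E := mix B z.1 z.2.
pose Q : {measure set (prod_space E) -> \bar R} :=
  measure_function_pushforward__canonical__measure_function_Measure
    (P \x P)%E (measurable_mixT B : measurable_fun setT mixB).
apply: (measure_unique cylinders (fun=> setT) measurable_cylinders cylindersI
  _ _ Q P _ _ S mS) => //=.
- move=> _; exists fset0, (fun=> setT); split => //.
  by apply/seteqP; split.
- by apply: bigcup_const; exists O.
- move=> _ [J [M [mM ->]]]; rewrite /pushforward.
  (* The preimage of a cylinder is a rectangle: sides in [B] constrain the first copy, the others
     the second. For each [a], one of the two factors is the total mass 1. *)
  pose M1 a := if `[< B a >] then M a else setT.
  pose M2 a := if `[< B a >] then setT else M a.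
  have mM1 a : measurable (M1 a) by rewrite /M1; case: ifP.
  have mM2 a : measurable (M2 a) by rewrite /M2; case: ifP.
  rewrite (_ : _ @^-1` _ = cylinder J M1 `*` cylinder J M2); last first.
    apply/seteqP; split => [[x y] Mxy|[x y] [/= Mx My]].
      by split => a aJ; have := Mxy a aJ; rewrite /= /M1 /M2 /mixB /mix /=; case: ifP.
    move=> a aJ; have := Mx a aJ; have := My a aJ.
    by rewrite /= /M1 /M2 /mixB /mix /=; case: ifP.
  have [mC1 mC2] := (measurable_cylinder J mM1, measurable_cylinder J mM2).
  rewrite product_measure1E // [LHS](_ : _ =
    (\prod_(a <- J) Pa a (M1 a) * \prod_(a <- J) Pa a (M2 a))%E); last first.
    by congr (_ * _)%E; exact: measure_cylinder.
  rewrite measure_cylinder // -big_split /=.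
  apply: eq_bigr => a _; rewrite /M1 /M2; case: ifP => _.
    by rewrite probability_setT mule1.
  by rewrite probability_setT mul1e.
- move=> _; rewrite /pushforward preimage_setT -setXTT product_measure1E //.
  by rewrite [X in (X * X)%E]probability_setT mule1 ltry.
Qed.

End product_measure.

(** * Partial means *)

Section mean.
Context (A : countType) (E : A -> ptopologicalType) (R : realType).
Context (Pa : forall a, probability (borel (E a)) R)
  (P : probability (prod_space E) R).
Hypothesis PaP : is_product_measure Pa P.
Implicit Types (B C : set A) (a : A) (Y : prod_space E -> R).
Local Notation coord_space B := (coord_space E B).
Local Notation mixp B := (fun z : prod_space E * prod_space E => mix B z.1 z.2).

(* Equal to 0 at the points x where the section of Y is not integrable. *)
Definition partial_mean B Y (x : prod_space E) : R :=
  \int[P]_y Y (mix B x y).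

Lemma integral_mix B (f : prod_space E -> \bar R) :
  measurable_fun [set: prod_space E] f ->
  (\int[(P \x P)]_z f (mix B z.1 z.2) = \int[P]_x f x)%E.
Proof.
move=> mf.
rewrite -(integral_pushforwardT (P \x P)%E (measurable_mixT B) mf).
apply: eq_measure_integral => [|? S mS _]; first exact: measurable_mixT.
exact: (measure_mix PaP B mS).
Qed.

Lemma ge0_integral_mean B (f : prod_space E -> \bar R) :
  measurable_fun [set: prod_space E] f -> (forall x, 0 <= f x)%E ->
  (\int[P]_x \int[P]_y f (mix B x y) = \int[P]_x f x)%E.
Proof.
move=> mf f0; rewrite -(integral_mix B mf).
rewrite (fubini_tonelli1 (fun z => f (mix B z.1 z.2))) //.
exact: (measurableT_comp mf (measurable_mixT B)).
Qed.

Lemma integrable_mix B (f : prod_space E -> \bar R) :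
  P.-integrable setT f -> (P \x P)%E.-integrable setT (f \o mixp B).
Proof.
move=> /integrableP[mf fy]; apply/integrableP; split.
  exact: (measurableT_comp mf (measurable_mixT B)).
rewrite (integral_mix B (f := fun x => `|f x|%E)) //.
exact: measurableT_comp.
Qed.

(** The integrand is jointly measurable in the coordinates of [x] in [B] and [C] and in the
    resampled [y]; Tonelli is applied to its positive and negative parts, and [fine] is
    measurable. *)
Lemma measurable_partial_mean B C Y : measurable_fun [set: coord_space C] Y ->
  measurable_fun [set: coord_space (B `&` C)] (partial_mean B Y).
Proof.
move=> mY.
have mYm := measurableT_comp mY (
  @measurable_mix _ E B C _ (@subset_refl _ _)).
apply: measurableT_comp; first exact: fine_measurable.
pose f (z : coord_space (B `&` C) * prod_space E) := (Y (mix B z.1 z.2))%:E.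
have mf : measurable_fun setT f by exact/measurable_EFinP.
rewrite (_ : (fun x => _) = fun x =>
    (\int[P]_y (f^\+ (x, y)) - \int[P]_y (f^\- (x, y)))%E); last first.
  apply/funext => x; rewrite integralE.
  by congr (_ - _)%E; apply: eq_integral => y _; rewrite ?funeposE ?funenegE.
apply: emeasurable_funB; apply: measurable_fun_fubini_tonelli_F => //.
  exact: measurable_funepos.
exact: measurable_funeneg.
Qed.

Lemma measurable_partial_meanT B Y : measurable_fun [set: prod_space E] Y ->
  measurable_fun [set: prod_space E] (partial_mean B Y).
Proof.
move=> /(measurable_partial_mean (B := B) (C := setT)).
exact: coord_space_measurable_fun_sub.
Qed.

Lemma measurable_section B Y x : measurable_fun [set: prod_space E] Y ->
  measurable_fun [set: prod_space E] (fun y => Y (mix B x y)).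
Proof.
by move=> mY; exact: (measurableT_comp (measurableT_comp mY (measurable_mixT B))
  (measurable_pair1 x)).
Qed.

Lemma integrable_section B Y : P.-integrable setT (EFin \o Y) ->
  {ae P, forall x, P.-integrable setT (EFin \o (fun y => Y (mix B x y)))}.
Proof. by move=> /(integrable_mix B) /ae_integrable1. Qed.

Lemma integrable_partial_mean B Y : P.-integrable setT (EFin \o Y) ->
  P.-integrable setT (EFin \o partial_mean B Y).
Proof.
move=> iY.
have mY : measurable_fun [set: prod_space E] Y.
  apply/measurable_EFinP; exact: measurable_int iY.
apply: (le_integrable measurableT _ _ (integrable_fubini_F (integrable_mix B iY))).
  by apply/measurable_EFinP; exact: measurable_partial_meanT.
(* [fine] sends infinite values to 0, so the Fubini integral dominates the partial mean at every
   point. *)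
have abs_fine_le (z : \bar R) : (`|(fine z)%:E| <= `|z|)%E.
  by case: z => [r| |] //=; rewrite normr0 leey.
by move=> x _; exact: abs_fine_le.
Qed.

Lemma integral_partial_mean B Y : P.-integrable setT (EFin \o Y) ->
  (\int[P]_x (partial_mean B Y x)%:E = \int[P]_x (Y x)%:E)%E.
Proof.
move=> iY; have iYm := integrable_mix B iY.
rewrite -(integral_mix B (measurable_int _ iY)) -(integral12_prod_meas1 iYm).
apply: ae_eq_integral => //.
- exact: measurable_int (integrable_partial_mean B iY).
- exact: measurable_int (integrable_fubini_F iYm).
(* Almost every section is integrable, and there [fine] loses nothing. *)
apply: filterS (integrable_section B iY) => x ix _.
by rewrite fineK //; exact: integrable_fin_num.
Qed.

(** The indicator of an event of $\sigma(X_B)$ does not change while the other coordinates are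
    integrated, so it comes out of the integral. *)
Lemma partial_mean_restrict B Y (S : set (prod_space E)) :
  @measurable _ (coord_space B) S ->
  partial_mean B (Y \_ S) = partial_mean B Y \_ S.
Proof.
move=> mS; apply/funext => x; rewrite patchE /partial_mean; case: ifPn.
  rewrite inE => Sx; apply: eq_Rintegral => y _; rewrite patchE mem_set //.
  by apply: (coord_event_invariant mS) Sx => a Ba; rewrite /mix asboolT.
rewrite notin_setE => Sx; rewrite (@eq_Rintegral _ _ _ _ _ (cst 0)).
  by rewrite [LHS]Rintegral_cst // mul0r.
move=> y _; rewrite patchE memNset // => Sxy; apply: Sx.
by apply: (coord_event_invariant mS) Sxy => a Ba; rewrite /mix asboolT.
Qed.

(** An event of the smaller sigma-field lies in $\sigma(X_B)$, so its indicator passes through the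
    partial mean, which preserves expectations. A general [C] is what allows one coordinate to be
    averaged out of $E[F\,|\,X_C]$. *)
Lemma partial_mean_condexp B C Y :
  measurable_fun [set: coord_space C] Y -> P.-integrable setT (EFin \o Y) ->
  is_condexp P (coord_events E (B `&` C)) Y (partial_mean B Y).
Proof.
move=> mY iY; split.
- exact: measurable_partial_mean.
- exact: integrable_partial_mean.
move=> S mS.
have mSB : @measurable _ (coord_space B) S.
  by apply: coord_space_measurable_sub mS; exact: subIsetl.
have mSP : @measurable _ (prod_space E) S by exact: coord_space_measurable_sub mSB.
rewrite integral_mkcond [RHS]integral_mkcond !restrict_EFin.
rewrite -partial_mean_restrict // integral_partial_mean //.
by rewrite -restrict_EFin; apply/(integrable_mkcond _ mSP)/(integrableS _ _ _ iY).
Qed.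

Lemma partial_meanT Y : partial_mean setT Y = Y.
Proof.
apply/funext => x; rewrite /partial_mean.
under eq_Rintegral do rewrite mixT.
by rewrite Rintegral_cst // [X in fine X]probability_setT mulr1.
Qed.

Lemma partial_mean0 Y x : partial_mean set0 Y x = fine 'E_P[Y].
Proof.
rewrite /partial_mean unlock; congr fine; apply: eq_integral => y _.
by rewrite mix0.
Qed.

(** The square inequality is applied on each section, then Tonelli on the glued point, whose law is
    [P]. *)
Lemma sqr_partial_mean_le B Y : measurable_fun [set: prod_space E] Y ->
  (\int[P]_x (partial_mean B Y x ^+ 2)%:E <= \int[P]_x (Y x ^+ 2)%:E)%E.
Proof.
move=> mY.
have mY2 : measurable_fun [set: prod_space E] (fun x => (Y x ^+ 2)%:E).
  by apply/measurable_EFinP; exact: measurable_funX.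
rewrite -(ge0_integral_mean B (f := fun x => (Y x ^+ 2)%:E)) //; last first.
  by move=> x; rewrite lee_fin sqr_ge0.
apply: ge0_le_integral => //.
- by move=> x _; rewrite lee_fin sqr_ge0.
- by apply/measurable_EFinP/measurable_funX; exact: measurable_partial_meanT.
- apply: (measurable_fun_fubini_tonelli_F (fun z => (Y (mix B z.1 z.2) ^+ 2)%:E)).
    exact: (measurableT_comp mY2 (measurable_mixT B)).
  by move=> z; rewrite lee_fin sqr_ge0.
- move=> x _; apply: sqr_Rintegral_le; exact: measurable_section.
Qed.

End mean.

(** * Gradient and conditional expectation *)

Section gradient.
Context (A : countType) (E : A -> ptopologicalType) (R : realType).
Context (Pa : forall a, probability (borel (E a)) R)
  (P : probability (prod_space E) R).
Hypothesis PaP : is_product_measure Pa P.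
Implicit Types (B C : set A) (a : A) (Y F : prod_space E -> R).
Local Notation coord_space B := (coord_space E B).

Lemma measurable_dfwith (x : prod_space E) a :
  measurable_fun [set: borel (E a)] (fun y => dfwith x a y : prod_space E).
Proof.
apply: measurable_fun_coord_space => b _.
have [ab|ab] := eqVneq a b; last first.
  rewrite (_ : (fun y => _) = cst (x b)); first exact: measurable_cst.
  by apply/funext => y; rewrite dfwithout.
case: b / ab; rewrite (_ : (fun y => _) = id); first exact: measurable_id.
by apply/funext => y; rewrite dfwithin.
Qed.

(** The coordinate [a] has law [Pa a] under [P], so integrating over it alone amounts to resampling
    the whole point and keeping all coordinates but [a]. The two default values coincide, hence an
    equality of functions. *)
Lemma grad_partial_mean a Y : measurable_fun [set: prod_space E] Y ->
  grad Pa a Y = Y \- partial_mean P (~` [set a]) Y.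
Proof.
move=> mY; apply/funext => x; rewrite /grad /=; congr (_ - fine _).
have mxa := @measurable_dfwith x a.
have ma := @measurable_coord A E setT a I.
transitivity (\int[pushforward P (fun y : prod_space E => y a : borel (E a))]_y
    (Y (dfwith x a y))%:E)%E.
  symmetry; apply: eq_measure_integral => S mS _.
  exact: (measure_coord PaP mS).
rewrite (integral_pushforwardT P ma
  (f := fun y : borel (E a) => (Y (dfwith x a y))%:E)).
  by apply: eq_integral => y _; rewrite mix_dfwith.
apply/measurable_EFinP; exact: (measurableT_comp mY mxa).
Qed.

Lemma is_condexp_ae_eq B F Y Y' :
  is_condexp P (coord_events E B) F Y -> is_condexp P (coord_events E B) F Y' ->
  {ae P, forall x, Y x = Y' x}.
Proof.
move=> [mY iY FY] [mY' iY' FY'].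
(* The identity map pushes [P] to its restriction [Q] to $\sigma(X_B)$. There both versions are
   measurable and have equal integrals over all measurable sets, hence agree almost everywhere. *)
pose forget (x : prod_space E) : coord_space B := x.
have mforget : measurable_fun setT forget.
  apply: measurable_fun_coord_space => a _.
  exact: (@measurable_coord A E setT a I).
pose Q : {measure set (coord_space B) -> \bar R} :=
  measure_function_pushforward__canonical__measure_function_Measure P mforget.
have iQ Z : measurable_fun [set: coord_space B] Z ->
    P.-integrable setT (EFin \o Z) -> Q.-integrable setT (EFin \o Z).
  move=> mZ iZ; apply: (integrable_pushforward mforget) => //.
  exact/measurable_EFinP.
have intQ Z S : measurable_fun [set: coord_space B] Z ->
    P.-integrable setT (EFin \o Z) -> @measurable _ (coord_space B) S ->
    (\int[Q]_(x in S) (Z x)%:E = \int[P]_(x in S) (Z x)%:E)%E.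
  move=> mZ iZ mS; apply: (integral_pushforward mforget (f := EFin \o Z)) => //.
    exact/measurable_EFinP.
  apply: integrableS iZ => //; exact: coord_space_measurable_sub mS.
have : ae_eq Q [set: coord_space B] (EFin \o Y) (EFin \o Y').
  apply: integral_ae_eq => //; first exact: iQ.
    exact/measurable_EFinP.
  by move=> S _ mS; rewrite intQ // intQ // FY // FY'.
move=> [N [mN N0 YN]]; exists N; split => //.
  exact: coord_space_measurable_sub mN.
by move=> x /= nYx; apply: YN => /= /(_ I)[].
Qed.

(** The tower property: events of $\sigma(X_B)$ can also be tested against the version for
    $\sigma(X_C)$. *)
Lemma is_condexp_trans B C F Y Z : B `<=` C ->
  is_condexp P (coord_events E C) F Y -> is_condexp P (coord_events E B) Y Z ->
  is_condexp P (coord_events E B) F Z.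
Proof.
move=> BC [_ _ FY] [mZ iZ YZ]; split => // S mS.
by rewrite YZ // FY //; exact: coord_space_measurable_sub mS.
Qed.

Lemma is_condexp_partial_mean B F : P.-integrable setT (EFin \o F) ->
  is_condexp P (coord_events E B) F (partial_mean P B F).
Proof.
move=> iF.
have mF : measurable_fun [set: coord_space setT] F.
  by apply/measurable_EFinP; exact: measurable_int iF.
by have := partial_mean_condexp PaP B mF iF; rewrite setIT.
Qed.

(** The partial mean shows that a version exists, so [xget] does not fall back on its default. *)
Lemma condexpP B F : P.-integrable setT (EFin \o F) ->
  is_condexp P (coord_events E B) F (condexp P (coord_events E B) F).
Proof.
move=> iF; apply: (@xgetPex _ _ (is_condexp P (coord_events E B) F)).
by exists (partial_mean P B F); exact: is_condexp_partial_mean.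
Qed.

Lemma condexp_ae_eq B F : P.-integrable setT (EFin \o F) ->
  {ae P, forall x, condexp P (coord_events E B) F x = partial_mean P B F x}.
Proof.
move=> iF; apply: is_condexp_ae_eq (condexpP B iF) _.
exact: is_condexp_partial_mean.
Qed.

Lemma measurable_condexp B F : P.-integrable setT (EFin \o F) ->
  measurable_fun [set: prod_space E] (condexp P (coord_events E B) F).
Proof.
move=> /(condexpP B)[mY _ _]; exact: (coord_space_measurable_fun_sub (B := B)) mY.
Qed.

Lemma grad_condexp_ae_eq B a F : P.-integrable setT (EFin \o F) ->
  {ae P, forall x, grad Pa a (condexp P (coord_events E B) F) x =
    partial_mean P B F x - partial_mean P (B `\ a) F x}.
Proof.
move=> iF; rewrite grad_partial_mean; last exact: measurable_condexp.
have [mY iY FY] := condexpP B iF.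
have : {ae P, forall x,
    partial_mean P (~` [set a]) (condexp P (coord_events E B) F) x =
    partial_mean P (B `\ a) F x}.
  apply: is_condexp_ae_eq (is_condexp_partial_mean _ iF).
  apply: (is_condexp_trans _ (condexpP B iF)); first exact: subDsetl.
  (* The chosen version is measurable for $\sigma(X_B)$, so averaging over [a] leaves dependence on
     [B] without [a] only. *)
  by rewrite setDE setIC; exact: (partial_mean_condexp PaP (~` [set a]) mY iY).
by apply: filterS2 (condexp_ae_eq B iF) => x /= -> ->.
Qed.

End gradient.

(** * Mean square estimates for partial means and conditional expectations *)

Section L2.
Context (A : countType) (E : A -> ptopologicalType) (R : realType).
Context (Pa : forall a, probability (borel (E a)) R)
  (P : probability (prod_space E) R).
Hypothesis PaP : is_product_measure Pa P.
Implicit Types (B : set A) (F G Y : prod_space E -> R).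
Local Notation L2norm f := ('N[P]_2%:E[EFin \o f])%E.

Lemma le_Lnorm2 F G :
  (\int[P]_x (F x ^+ 2)%:E <= \int[P]_x (G x ^+ 2)%:E)%E ->
  (L2norm F <= L2norm G)%E.
Proof.
move=> FG; rewrite !Lnorm2E gt0_ler_poweR ?invr_ge0 //.
  by rewrite in_itv /= leey andbT integral_ge0 // => x _; rewrite lee_fin sqr_ge0.
by rewrite in_itv /= leey andbT integral_ge0 // => x _; rewrite lee_fin sqr_ge0.
Qed.

Lemma ae_eq_Lnorm2 F G :
  measurable_fun [set: prod_space E] F -> measurable_fun [set: prod_space E] G ->
  {ae P, forall x, F x = G x} -> L2norm F = L2norm G.
Proof.
move=> mF mG FG; rewrite !Lnorm2E; congr (_ `^ _)%E.
apply: ae_eq_integral => //.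
- exact/measurable_EFinP/measurable_funX.
- exact/measurable_EFinP/measurable_funX.
- by apply: filterS FG => x /= ->.
Qed.

Lemma partial_mean_Lfun B Y : Y \in Lfun P 2%:E ->
  partial_mean P B Y \in Lfun P 2%:E.
Proof.
move=> /Lfun2P[mY Yy]; apply/Lfun2P; split.
  exact: (measurable_partial_meanT P B mY).
by apply: le_lt_trans Yy; exact: (sqr_partial_mean_le PaP B mY).
Qed.

Lemma condexp_Lfun B F : F \in Lfun P 2%:E ->
  condexp P (coord_events E B) F \in Lfun P 2%:E.
Proof.
move=> F2; have iF := Lfun2_integrable F2; have mY := measurable_condexp PaP B iF.
have /Lfun2P[mF' F'y] := partial_mean_Lfun B F2.
apply/Lfun2P; split; first exact: mY.
rewrite (_ : (\int[P]_x _)%E = \int[P]_x (partial_mean P B F x ^+ 2)%:E)%E //.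
apply: ae_eq_integral => //.
- exact/measurable_EFinP/measurable_funX.
- exact/measurable_EFinP/measurable_funX.
- by apply: filterS (condexp_ae_eq PaP B iF) => x /= ->.
Qed.

Lemma Lfun2B F G : F \in Lfun P 2%:E -> G \in Lfun P 2%:E ->
  (F \- G) \in Lfun P 2%:E.
Proof.
by move=> F2 G2; rewrite rpredB ?lee1n.
Qed.

(** Dropping the nonnegative gradient term turns approximation in the Sobolev norm into
    approximation in $L^2$. *)
Lemma Lnorm2_le_norm12 F : (L2norm F <= norm12 Pa P F)%E.
Proof.
rewrite Lnorm2E /norm12 gt0_ler_poweR ?invr_ge0 //.
- by rewrite in_itv /= leey andbT integral_ge0 // => x _; rewrite lee_fin sqr_ge0.
- rewrite in_itv /= leey andbT adde_ge0 //.
    by apply: integral_ge0 => x _; rewrite lee_fin sqr_ge0.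
  apply: esum_ge0 => a _.
  by apply: integral_ge0 => x _; rewrite lee_fin sqr_ge0.
rewrite leeDl // esum_ge0 // => a _.
by apply: integral_ge0 => x _; rewrite lee_fin sqr_ge0.
Qed.

Lemma partial_mean_invariant B G :
  (forall x y : prod_space E, (forall a, B a -> x a = y a) -> G x = G y) ->
  partial_mean P B G = G.
Proof.
move=> GB; apply/funext => x; rewrite /partial_mean.
rewrite (@eq_Rintegral _ _ _ _ _ (cst (G x))).
  by rewrite Rintegral_cst // [X in fine X]probability_setT mulr1.
by move=> y _; apply: GB => a Ba; rewrite /mix asboolT.
Qed.

Lemma Lnorm2_partial_meanB B F G :
  (forall x y : prod_space E, (forall a, B a -> x a = y a) -> G x = G y) ->
  F \in Lfun P 2%:E -> G \in Lfun P 2%:E ->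
  (L2norm (partial_mean P B F \- F)%R <= L2norm (F \- G)%R + L2norm (F \- G)%R)%E.
Proof.
move=> GB F2 G2; have FG2 := Lfun2B F2 G2; have GF2 := Lfun2B G2 F2.
have /Lfun2P[mF _] := F2; have /Lfun2P[mG _] := G2.
have /Lfun2P[mFG _] := FG2; have /Lfun2P[mGF _] := GF2.
have mM := measurable_partial_meanT P B mFG.
rewrite (ae_eq_Lnorm2 (G := partial_mean P B (F \- G) \+ (G \- F))).
- apply: (le_trans (minkowski_EFin P mM mGF _)); first by rewrite ler1n.
  apply: leeD.
    by apply: le_Lnorm2; exact: (sqr_partial_mean_le PaP B mFG).
  apply: le_Lnorm2; rewrite le_eqVlt; apply/orP; left; apply/eqP.
  by apply: eq_integral => x _ /=; rewrite -sqrrN opprB.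
- exact: measurable_funB (measurable_partial_meanT P B mF) mF.
- exact: measurable_funD mM mGF.
(* Linearity of the partial mean is applied at points where the sections of [F] and [G] are both
   integrable. *)
apply: filterS2 (integrable_section PaP B (Lfun2_integrable F2))
  (integrable_section PaP B (Lfun2_integrable G2)) => x ix gx /=.
rewrite [partial_mean P B (F \- G) x]RintegralB //.
rewrite -/(partial_mean P B G x) -/(partial_mean P B F x).
rewrite (partial_mean_invariant GB).
by rewrite addrA subrK.
Qed.

End L2.

(** * The representation formulas for ordered and for unordered coordinates *)

Lemma clark_ordered (R : realType) (E : nat -> ptopologicalType)
    (Pa : forall a, probability (borel (E a)) R)
    (P : probability (prod_space E) R) (F : prod_space E -> R) :
  is_product_measure Pa P -> sobolev Pa P F ->
  L2_series P
    (fun k => grad Pa k (condexp P (coord_events E [set j | (j <= k)%N]) F))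
    (fun x => F x - fine ('E_P[F])).
Proof.
move=> PaP [F2 FD]; have iF := Lfun2_integrable F2.
pose below n := `I_n.
pose u k := grad Pa k (condexp P (coord_events E [set j | (j <= k)%N]) F).
have u2 k : u k \in Lfun P 2%:E.
  rewrite /u (grad_partial_mean PaP); last exact: (measurable_condexp PaP _ iF).
  apply: Lfun2B; first exact: (condexp_Lfun PaP _ F2).
  exact/(partial_mean_Lfun PaP)/(condexp_Lfun PaP).
have mF : measurable_fun [set: prod_space E] F by have /Lfun2P[] := F2.
have S2 : (fun x => F x - fine 'E_P[F]) \in Lfun P 2%:E.
  exact: (Lfun2B F2 (Lfun_cst P _ _)).
split => //.
(* Indices start at 0: conditioning on [j <= k] means [below k.+1], and removing [k] leaves
   [below k]. Countably many null sets are merged into one. *)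
have ae_telescope : {ae P, forall x, forall k,
    u k x = partial_mean P (below k.+1) F x - partial_mean P (below k) F x}.
  apply/ae_foralln => k.
  rewrite (_ : below k = [set j | (j <= k)%N] `\ k); last first.
    apply/seteqP; split => j /=; rewrite /below /= ltn_neqAle.
      by move=> /andP[/eqP jk lejk].
    by move=> [-> /eqP ->].
  exact: (grad_condexp_ae_eq PaP).
(* The first [n] terms telescope from the empty set, whose partial mean is the expectation; this
   cancels the constant in the limit. *)
have ae_sum n : ('N[P]_2%:E[EFin \o
      (fun x => \sum_(k < n) u k x - (F x - fine 'E_P[F]))%R])%E =
    ('N[P]_2%:E[EFin \o (partial_mean P (below n) F \- F)%R])%E.
  apply: ae_eq_Lnorm2.
  - apply: measurable_funB; last by have /Lfun2P[] := S2.
    by apply: measurable_sum => k; have /Lfun2P[] := u2 k.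
  - apply: measurable_funB => //; exact: measurable_partial_meanT.
  apply: filterS ae_telescope => x ux /=.
  under eq_bigr do rewrite ux.
  rewrite -(big_mkord xpredT (fun k =>
    partial_mean P (below k.+1) F x - partial_mean P (below k) F x)).
  rewrite telescope_sumr // (_ : below 0%N = set0) ?partial_mean0.
    by rewrite opprB addrA subrK.
  by apply/seteqP; split.
under eq_fun do rewrite ae_sum.
apply: cvge0_lt => [n|e e0]; first exact: Lnorm_ge0.
(* The error bound contains the distance from [F] to [G] twice, hence [e / 2]. *)
have [G [G2 [B finB GB]] FGe] := FD (e / 2) (divr_gt0 e0 (ltr0n _ 2)).
have FG := le_lt_trans (Lnorm2_le_norm12 Pa P _) FGe.
(* From [n0] on, the first [n] coordinates include all those on which [G] depends. *)
have [n0 Bn0] : exists n0, B `<=` below n0.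
  have /finite_seqP[s ->] := finB.
  by exists (\max_(i <- s) i).+1 => i /= si; rewrite /below /= ltnS leq_bigmax_seq.
exists n0 => n n0n.
apply: (@le_lt_trans _ _ _ _ _ (Lnorm2_partial_meanB PaP _ F2 G2)).
  move=> x y xy; apply: GB => a /Bn0 an0; apply: xy.
  exact: leq_trans an0 n0n.
by have := lteD FG FG; rewrite -EFinD -splitr.
Qed.

Lemma clark_unordered (R : realType) (A : finType) (E : A -> ptopologicalType)
    (Pa : forall a, probability (borel (E a)) R)
    (P : probability (prod_space E) R) (F : prod_space E -> R) :
  is_product_measure Pa P -> P.-integrable setT (EFin \o F) ->
  {ae P, forall x, F x = fine ('E_P[F]) +
      \sum_(B : {set A} | B != finset.set0)
        ('C(#|A|, #|B|)%:R)^-1 * (#|B|%:R)^-1 *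
        \sum_(b in B) grad Pa b (condexp P (coord_events E [set` B]) F) x}.
Proof.
move=> PaP iF.
pose g x (B : {set A}) := partial_mean P [set` B] F x.
have : {ae P, forall x, forall p : {set A} * A,
    grad Pa p.2 (condexp P (coord_events E [set` p.1]) F) x =
    g x p.1 - g x (p.1 :\ p.2)%SET}.
  (* There are finitely many pairs of a subset and a point, so one null set serves for all; off it
     the subset identity applies pointwise. *)
  apply: filter_forall => -[B b] /=.
  rewrite /g (_ : [set` (B :\ b)%SET] = [set` B] `\ b).
    exact: (grad_condexp_ae_eq PaP).
  apply/seteqP; split => a /=; rewrite finset.in_setD1.
    by move=> /andP[/eqP ab aB].
  by move=> [-> /eqP ->].
apply: filterS => x gx.
under eq_bigr do under eq_bigr do rewrite (gx (_, _)) /=.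
rewrite sum_subset_increments /g.
rewrite (_ : [set` finset.setT] = setT); last first.
  by apply/seteqP; split => a //=; rewrite inE.
rewrite (_ : [set` finset.set0] = set0); last first.
  by apply/seteqP; split => a //=; rewrite inE.
by rewrite partial_meanT partial_mean0 addrC subrK.
Qed.

Theorem theorem3p3 (R : realType) :
  (forall (E : nat -> ptopologicalType)
      (Pa : forall a, probability (borel (E a)) R)
      (P : probability (prod_space E) R) (F : prod_space E -> R),
    (forall a, polish R (E a)) ->
    is_product_measure Pa P ->
    sobolev Pa P F ->
    L2_series P
      (fun k => grad Pa k (condexp P (coord_events E [set j | (j <= k)%N]) F))
      (fun x => F x - fine ('E_P[F])))
  /\
  (forall (A : finType) (E : A -> ptopologicalType)
      (Pa : forall a, probability (borel (E a)) R)
      (P : probability (prod_space E) R) (F : prod_space E -> R),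
    (forall a, polish R (E a)) ->
    is_product_measure Pa P ->
    sobolev Pa P F ->
    {ae P, forall x, F x = fine ('E_P[F]) +
      \sum_(B : {set A} | B != finset.set0)
        ('C(#|A|, #|B|)%:R)^-1 * (#|B|%:R)^-1 *
        \sum_(b in B) grad Pa b (condexp P (coord_events E [set` B]) F) x}).
Proof.
split=> [E Pa P F _ PaP FD|A E Pa P F _ PaP [F2 _]].
  exact: (clark_ordered PaP FD).
exact: (clark_unordered PaP (Lfun2_integrable F2)).
Qed.
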